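(* Let $(\mathfrak X,\|\cdot\|)$ be a Banach space and let $\mu$ be a Borel probability measure on $\mathfrak X$ with $\int_{\mathfrak X}\|x\|\,\mu(dx)<\infty$. Then for every $n\in\mathbb N$ $$e_n^{\mathrm{det}} = q_n ,$$ where $e_n^{\mathrm{det}}$ is the $n$-th minimal worst case error of (broad sense) deterministic algorithms for integrating Lipschitz functionals with respect to $\mu$, and $q_n$ is the $n$-th quantization number of $\mu$ of order one.
   Context: $\mathbb N=\{1,2,\dots\}$. $F$ denotes the class of all functionals $f:\mathfrak X\to\mathbb R$ with $|f(x)-f(y)|\le\|x-y\|$ for all $x,y\in\mathfrak X$, and $S(f)=\int_{\mathfrak X}f(x)\,\mu(dx)$ for $f\in F$. Deterministic algorithms. $\mathbb S^{\mathrm{det}}$ is the class of all mappings $\widehat S:F\to\mathbb R$ arising as follows from a point $x_1\in\mathfrak X$ and arbitrary mappings $\psi_\ell:\mathbb R^{\ell-1}\to\mathfrak X$ ($\ell\ge2$), $\tau_\ell:\mathbb R^\ell\to\{0,1\}$ ($\ell\ge1$), $\phi_\ell:\mathbb R^\ell\to\mathbb R$ ($\ell\ge1$). For $f\in F$ put $y_1=f(x_1)$ and $y_\ell=f(\psi_\ell(y_1,\dots,y_{\ell-1}))$ for $\ell\ge2$; let $n(f)=\min\{\ell\ge1:\tau_\ell(y_1,\dots,y_\ell)=1\}$, which is assumed to be finite for every $f\in F$; then $\widehat S(f)=\phi_{n(f)}(y_1,\dots,y_{n(f)})$. The mapping $\widehat S$ is identified with these data, and $\mathrm{card}(\widehat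 S,f)=n(f)$. Define $e(\widehat S)=\sup_{f\in F}|S(f)-\widehat S(f)|$, $\mathrm{card}(\widehat S)=\sup_{f\in F}\mathrm{card}(\widehat S,f)$ and $$e_n^{\mathrm{det}}=\inf\{e(\widehat S):\widehat S\in\mathbb S^{\mathrm{det}},\ \mathrm{card}(\widehat S)\le n\}.$$ Quantization numbers. $q_n=\inf_{x_1,\dots,x_n\in\mathfrak X}\int_{\mathfrak X}\min_{i=1,\dots,n}\|x-x_i\|\,\mu(dx)$. *)

(* Defs.v *)
From HB Require Import structures.
From mathcomp Require Import all_boot all_order all_algebra.
From mathcomp Require Import all_classical all_reals all_analysis.

Set Implicit Arguments.
Unset Strict Implicit.
Unset Printing Implicit Defensive.

Import Order.TTheory GRing.Theory Num.Theory.
Import numFieldNormedType.Exports.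

Local Open Scope classical_set_scope.
Local Open Scope ring_scope.

(* The measurable type carried by X for its Borel sigma-algebra; it is
   convertible to X, so functions on X can be integrated directly. *)
Notation borel X := (g_sigma_algebraType (@open X)).

Section Algorithms.
Variables (R : realType) (X : completeNormedModType R).

Record lip1 := Lip1 {
  lip1_fun :> X -> R;
  lip1P : 1.-lipschitz lip1_fun }.

(* All indices are shifted so that only nonempty tuples occur:
   [alg_psi l] is psi_(l+2), [alg_tau l] is tau_(l+1), [alg_phi l] is
   phi_(l+1). *)
Record det_data := DetData {
  alg_x1 : X;
  alg_psi : forall l : nat, l.+1.-tuple R -> X;
  alg_tau : forall l : nat, l.+1.-tuple R -> bool;
  alg_phi : forall l : nat, l.+1.-tuple R -> R }.

(* [observations A f l] is (y_1, ..., y_(l+1)). *)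
Fixpoint observations (A : det_data) (f : X -> R) (l : nat) : l.+1.-tuple R :=
  match l with
  | 0 => [tuple f (alg_x1 A)]
  | l'.+1 => let y := observations A f l' in [tuple of rcons y (f (alg_psi A y))]
  end.

Definition stops_at (A : det_data) (f : X -> R) : pred nat :=
  fun l => alg_tau A (observations A f l).

(* An algorithm is given by its data, not merely by the induced mapping
   from Lipschitz functionals to reals, as its cardinality depends on them. *)
Record det_alg := DetAlg {
  det_alg_data :> det_data;
  det_alg_halts : forall f : lip1, exists l, stops_at det_alg_data f l }.

(* n(f) - 1, in accordance with the index shift. *)
Definition stop_index (A : det_alg) (f : lip1) : nat :=
  ex_minn (det_alg_halts A f).

Definition alg_card_at (A : det_alg) (f : lip1) : nat := (stop_index A f).+1.

Definition alg_eval (A : det_alg) (f : lip1) : R :=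
  alg_phi A (observations A f (stop_index A f)).

Definition alg_card (A : det_alg) : \bar R :=
  ereal_sup [set ((alg_card_at A f)%:R)%:E | f in [set: lip1]].

Variable mu : probability (borel X) R.

(* The real-valued integral; a Lipschitz functional is mu-integrable as soon
   as the norm is. *)
Definition lip1_integral (f : lip1) : R := \int[mu]_x f x.

Definition alg_error (A : det_alg) : \bar R :=
  ereal_sup [set (`|lip1_integral f - alg_eval A f|)%:E | f in [set: lip1]].

Definition e_det (n : nat) : \bar R :=
  ereal_inf [set alg_error A | A in
    [set A : det_alg | (alg_card A <= (n%:R)%:E)%E]].

(* For n > 0 the value +oo of the empty minimum plays no role. *)
Definition quantization (n : nat) : \bar R :=
  ereal_inf [set (\int[mu]_x \big[Order.min/+oo]_(i < n) (`|(x : X) - xs i|)%:E)%E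
            | xs in [set: 'I_n -> X]].

End Algorithms.

(* Main.v *)
Require Import Defs.
From mathcomp Require Import all_boot all_order all_algebra.
From mathcomp Require Import all_classical all_reals all_analysis.
From mathcomp Require Import measurable_realfun lra.
Import Order.TTheory GRing.Theory Num.Theory.
Import numFieldNormedType.Exports.
Local Open Scope classical_set_scope.
Local Open Scope ring_scope.

(** Both quantities reduce to the integral of [node_dist xs], the distance to
    the finite set of nodes [xs], so it suffices to compare the algorithms with
    the configurations of [n] nodes.

    Lower bound: an algorithm may choose its queries adaptively, but if it only
    ever sees zeros, its queries are those it makes for the zero functional,
    and it stops within the first [n] of them. The distance [d] to these [n]
    points and [- d] are Lipschitz functionals that both look like zero to the algorithm, which thus returns
    the same number for both; as their integrals are opposite, one of the two
    errors is at least the integral of [d] ([eq_alg_eval], [alg_error_ge]).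

    Upper bound: given nodes [xs], evaluate the functional at all of them. The
    Lipschitz functionals with the observed values lie between two McShane
    envelopes, which belong to the class themselves. Returning the mean of the
    integrals of the envelopes costs at most half the integral of their gap,
    and the gap at [x] is at most twice the distance from [x] to the nearest
    node ([mcshane_gap], [central_value_error]). Working with envelopes rather
    than with a quadrature formula weighted by the masses of Voronoi cells
    avoids constructing a measurable nearest-node selection.

    All functionals involved are Lipschitz, hence continuous and dominated by an
    affine function of the norm, which makes them integrable
    ([lip1_integrable]). *)

(** * Lipschitz functionals and McShane envelopes *)

Section Envelopes.
Context {R : realType} {X : completeNormedModType R}.
Implicit Types (f : lip1 X) (x y : X).

Lemma lip1_distle f x y : `|f x - f y| <= `|x - y|.
Proof. by have := lip1P f (conj I I : (setT `*` setT) (x, y)); rewrite /= mul1r. Qed.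

Lemma lip1_le f x y : f x <= f y + `|x - y|.
Proof. by rewrite -lerBlDl (le_trans (ler_norm _)) ?lip1_distle. Qed.

(** Exchanging the two points turns the one-sided bound into the other half
    of the absolute value. *)
Lemma one_sided_lipschitz (h : X -> R) :
  (forall x y, h x <= h y + `|x - y|) -> 1.-lipschitz h.
Proof.
move=> hle [x y] _ /=; rewrite mul1r ler_norml.
by have := hle x y; have := hle y x; rewrite (distrC y x); lra.
Qed.

Lemma zero_lipschitz : 1.-lipschitz (fun _ : X => 0 : R).
Proof. by apply: one_sided_lipschitz => x y; rewrite add0r. Qed.

Definition lip1_zero : lip1 X := Lip1 zero_lipschitz.

Lemma oppr_lipschitz f : 1.-lipschitz (fun x => - f x).
Proof.
by apply: one_sided_lipschitz => x y; have := lip1_le f y x; rewrite distrC; lra.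
Qed.

Definition lip1_opp f : lip1 X := Lip1 (oppr_lipschitz f).

Section McShane.
Context {m : nat}.
Context (xs : 'I_m.+1 -> X).
Implicit Types a : 'I_m.+1 -> R.

(** The minimum is seeded with one of its own terms, which makes it the genuine
    minimum over the nonempty set of nodes. *)
Definition mcshane_fun a x : R :=
  \big[Order.min/a ord0 + `|x - xs ord0|]_i (a i + `|x - xs i|).

Lemma mcshane_le a x i : mcshane_fun a x <= a i + `|x - xs i|.
Proof. exact: bigmin_le. Qed.

Lemma mcshane_attained a x : exists i, mcshane_fun a x = a i + `|x - xs i|.
Proof.
rewrite /mcshane_fun; elim/big_ind: _ => [|u v [i ->] [j ->]|i _].
- by exists ord0.
- by rewrite /Order.min; case: ifP => _; [exists i | exists j].
- by exists i.
Qed.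

(** A minimum of functionals with constant 1 has constant 1: bound the minimum
    at [x] by the term that is minimal at [y]. *)
Lemma mcshane_lipschitz a : 1.-lipschitz (mcshane_fun a).
Proof.
apply: one_sided_lipschitz => x y; have [i ->] := mcshane_attained a y.
rewrite (le_trans (mcshane_le a x i))// -addrA lerD2l [leRHS]addrC.
exact: ler_distD.
Qed.

Definition mcshane a : lip1 X := Lip1 (mcshane_lipschitz a).

(** Prescribing the value 0 at all nodes yields the distance to the set of
    nodes, which is the integrand in the quantization numbers. *)
Definition node_dist : lip1 X := mcshane (fun=> 0).

Lemma node_dist_le x i : node_dist x <= `|x - xs i|.
Proof. by rewrite -[leRHS]add0r; exact: mcshane_le. Qed.

Lemma node_dist_attained x : exists i, node_dist x = `|x - xs i|.
Proof.
by have [i Ei] := mcshane_attained (fun=> 0) x; exists i; rewrite /= Ei add0r.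
Qed.

Lemma node_dist_node i : node_dist (xs i) = 0.
Proof.
have [j dj] := node_dist_attained (xs i).
apply/eqP; rewrite eq_le {2}dj normr_ge0 andbT.
by have := node_dist_le (xs i) i; rewrite subrr normr0.
Qed.

Lemma node_distE x :
  (\big[Order.min/+oo]_(i < m.+1) (`|x - xs i|)%:E = (node_dist x)%:E)%E.
Proof.
apply/eqP; rewrite eq_le; apply/andP; split.
  by have [i ->] := node_dist_attained x; exact: bigmin_le.
apply: le_bigmin => [|i _]; first by rewrite leey.
by rewrite lee_fin node_dist_le.
Qed.

(** Each term of the minimum is the growth bound for [f] from one node, which is
    what makes McShane extensions upper envelopes. *)
Lemma le_mcshane f x : f x <= mcshane (f \o xs) x.
Proof.
by have [i Ei] := mcshane_attained (f \o xs) x; rewrite /= Ei; exact: lip1_le.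
Qed.

(** [mcshane a] and the opposite of [mcshane (- a)] are the upper and lower
    envelopes of the data [a]; their gap at [x] is measured at the node
    nearest to [x]. *)
Lemma mcshane_gap a x :
  mcshane a x + mcshane (fun i => - a i) x <= 2 * node_dist x.
Proof.
have [i ->] := node_dist_attained x.
have := mcshane_le a x i; have := mcshane_le (fun i => - a i) x i.
by rewrite /=; lra.
Qed.

End McShane.
End Envelopes.

(** * Integration of Lipschitz functionals *)

Section Integration.
Context {R : realType} {X : completeNormedModType R}.

Lemma continuous_borel_measurable (h : X -> R) :
  continuous h -> measurable_fun [set: borel X] h.
Proof.
move=> /continuousP hc; apply: (measurability _ (RGenOpens.measurableE R)).
move=> _ [_ [a [b ->] <-]]; rewrite setTI.
by apply: sub_sigma_algebra; apply: hc; exact: interval_open.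
Qed.

Lemma lip1_continuous (f : lip1 X) : continuous f.
Proof.
move=> x; apply/cvgrPdist_le => e e0; near=> y.
rewrite (le_trans (lip1_distle f x y))//.
Unshelve. all: by end_near. Qed.

Context {mu : probability (borel X) R}.
Context (hmu : (\int[mu]_x (`|(x : X)|)%:E < +oo)%E).

Lemma lip1_integrable (f : lip1 X) :
  mu.-integrable [set: borel X] (EFin \o (f : borel X -> R)).
Proof.
(* f is dominated by `|f 0| + `|x|, and mu is finite *)
have inorm : mu.-integrable [set: borel X] (fun x => (`|(x : X)|)%:E).
  apply/integrableP; split.
    apply/measurable_EFinP; apply: continuous_borel_measurable.
    by move=> x; exact: norm_continuous.
  by under eq_integral do rewrite gee0_abs ?lee_fin//.
have icst : mu.-integrable [set: borel X] (cst (`|f 0|%:E)).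
  exact: finite_measure_integrable_cst.
apply: (le_integrable _ _ _ (integrableD _ icst inorm)) => //.
  apply/measurable_EFinP; apply: continuous_borel_measurable.
  exact: lip1_continuous.
move=> x _ /=; rewrite lee_fin [leRHS]ger0_norm ?addr_ge0//.
have := ler_normD (f x - f 0) (f 0); have := lip1_distle f x 0.
by rewrite subr0 subrK; lra.
Qed.

Lemma le_lip1_integral {f g : lip1 X} :
  (forall x, f x <= g x) -> lip1_integral mu f <= lip1_integral mu g.
Proof. by move=> fg; apply: le_Rintegral => //; exact: lip1_integrable. Qed.

Lemma lip1_integral_opp (f : lip1 X) :
  lip1_integral mu (lip1_opp f) = - lip1_integral mu f.
Proof.
rewrite /lip1_integral -mulN1r -RintegralZl//; last exact: lip1_integrable.
by apply: eq_Rintegral => x _; rewrite mulN1r.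
Qed.

Lemma lip1_integral_gap {f g h : lip1 X} : (forall x, f x + g x <= 2 * h x) ->
  lip1_integral mu f + lip1_integral mu g <= 2 * lip1_integral mu h.
Proof.
move=> fgh; have int := lip1_integrable.
rewrite /lip1_integral -RintegralD// -RintegralZl//; apply: le_Rintegral => //.
- exact: (integrableD measurableT (int f) (int g)).
- exact: (integrableZl measurableT 2 (int h)).
Qed.

Lemma integral_min_dist m (xs : 'I_m.+1 -> X) :
  (\int[mu]_x \big[Order.min/+oo]_(i < m.+1) (`|(x : X) - xs i|)%:E =
   (lip1_integral mu (node_dist xs))%:E)%E.
Proof.
under eq_integral do rewrite node_distE.
by rewrite fineK//; apply: integrable_fin_num => //; exact: lip1_integrable.
Qed.

End Integration.

(** * Lower bound: fooling functionals *)

Section LowerBound.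
Context {R : realType} {X : completeNormedModType R}.

Definition query (A : det_data X) (f : X -> R) (l : nat) : X :=
  if l is l'.+1 then alg_psi A (observations A f l') else alg_x1 A.

Lemma observationsS (A : det_data X) (f : X -> R) l :
  observations A f l.+1 =
  [tuple of rcons (observations A f l) (f (query A f l.+1))].
Proof. by []. Qed.

(** Adaptive queries depend on the functional only through its earlier values,
    so agreement at the points queried for one functional propagates. *)
Lemma eq_observations (A : det_data X) (f g : X -> R) l :
  (forall j, (j <= l)%N -> f (query A g j) = g (query A g j)) ->
  observations A f l = observations A g l.
Proof.
elim: l => [|l IH] fg; first by apply: val_inj; rewrite /= (fg 0%N).
have eqo : observations A f l = observations A g l.
  by apply: IH => j jl; apply: fg; exact: leqW.
by rewrite !observationsS -(fg l.+1)//= eqo.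
Qed.

(** The stopping rule, too, sees only the observed values: below the stopping
    index of [g] the two runs coincide, so they stop together. *)
Lemma eq_alg_eval (A : det_alg X) (f g : lip1 X) :
  (forall j, (j <= stop_index A g)%N -> f (query A g j) = g (query A g j)) ->
  alg_eval A f = alg_eval A g.
Proof.
move=> fg.
have eqo l : (l <= stop_index A g)%N -> observations A f l = observations A g l.
  by move=> lg; apply: eq_observations => j jl; apply: fg; exact: leq_trans lg.
suff E : stop_index A f = stop_index A g by rewrite /alg_eval E eqo.
have sg : stops_at A g (stop_index A g) by rewrite /stop_index; case: ex_minnP.
have ming l : stops_at A g l -> (stop_index A g <= l)%N.
  by rewrite /stop_index; case: ex_minnP => k _; exact.
rewrite {1}/stop_index; case: ex_minnP => k sk mink.
have kg : (k <= stop_index A g)%N by apply: mink; rewrite /stops_at eqo.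
apply/eqP; rewrite eqn_leq kg; apply: ming.
by move: sk; rewrite /stops_at eqo.
Qed.

(** The nodes are the first [m.+1] queries for the zero functional, continued
    past the stop if it comes earlier. The distance [d] to them and its opposite
    produce the same data, hence the same output; one of the two
    integrals, which differ by twice that of [d], must be missed by at least
    the integral of [d]. *)
Lemma alg_error_ge (mu : probability (borel X) R)
    (hmu : (\int[mu]_x (`|(x : X)|)%:E < +oo)%E) m (A : det_alg X) :
  (alg_card A <= (m.+1%:R)%:E)%E ->
  ((lip1_integral mu
     (node_dist (fun i : 'I_m.+1 => query A lip1_zero i)))%:E
   <= alg_error mu A)%E.
Proof.
move=> cardA; set d := node_dist _.
have stop0 : (stop_index A lip1_zero <= m)%N.
  rewrite -ltnS -(ler_nat R) -lee_fin (le_trans _ cardA)//.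
  by apply: ereal_sup_ubound; exists lip1_zero.
have d0 j : (j <= stop_index A lip1_zero)%N -> d (query A lip1_zero j) = 0.
  move=> jl; have jm : (j < m.+1)%N by rewrite ltnS (leq_trans jl).
  exact: (node_dist_node (fun i : 'I_m.+1 => query A lip1_zero i) (Ordinal jm)).
have evp : alg_eval A d = alg_eval A lip1_zero by apply: eq_alg_eval.
have evn : alg_eval A (lip1_opp d) = alg_eval A lip1_zero.
  by apply: eq_alg_eval => j /d0 /= ->; rewrite oppr0.
set I := lip1_integral mu d; set c := alg_eval A lip1_zero.
have errp : ((`|I - c|)%:E <= alg_error mu A)%E.
  by rewrite /c -evp; apply: ereal_sup_ubound; exists d.
have errn : ((`|- I - c|)%:E <= alg_error mu A)%E.
  rewrite /c -evn /I -lip1_integral_opp//.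
  by apply: ereal_sup_ubound; exists (lip1_opp d).
(* the sign of the output decides on which of the two it is worse *)
have [c0|c0] := leP c 0.
- by rewrite (le_trans _ errp)// lee_fin (le_trans _ (ler_norm _))//; lra.
- rewrite (le_trans _ errn)// lee_fin -normrN.
  by rewrite (le_trans _ (ler_norm _))//; lra.
Qed.

End LowerBound.

(** * Upper bound: the central algorithm *)

Section UpperBound.
Context {R : realType} {X : completeNormedModType R}.
Context (mu : probability (borel X) R) {m : nat} (xs : 'I_m.+1 -> X).

(** Mean of the integrals of the upper and lower envelopes of the data [a]; the
    lower one is the opposite of [mcshane xs (- a)], whence the minus sign. *)
Definition central_value (a : 'I_m.+1 -> R) : R :=
  (lip1_integral mu (mcshane xs a) -
   lip1_integral mu (mcshane xs (fun i => - a i))) / 2.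

Lemma central_value_error (f : lip1 X)
    (hmu : (\int[mu]_x (`|(x : X)|)%:E < +oo)%E) :
  `|lip1_integral mu f - central_value (f \o xs)| <=
  lip1_integral mu (node_dist xs).
Proof.
have ub := le_lip1_integral hmu (le_mcshane xs f).
have lb := le_lip1_integral hmu (le_mcshane xs (lip1_opp f)).
rewrite lip1_integral_opp// in lb.
have gap := lip1_integral_gap hmu (mcshane_gap xs (f \o xs)).
rewrite /central_value ler_norml; move: ub lb gap => /=.
rewrite -[lip1_opp f \o xs]/(fun i => - (f \o xs) i).
by lra.
Qed.

(** The nodes are queried in order, whatever the answers. The entry of index
    [l] of the data concerns a run of [l.+1] queries, hence the stop at [m];
    the output is then read from [m.+1] values, within the range of [nth]. *)
Definition central_data : det_data X := {|
  alg_x1 := xs ord0;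
  alg_psi := fun l _ => xs (inord l.+1);
  alg_tau := fun l _ => l == m;
  alg_phi := fun _ t => central_value (fun i => nth 0 t i) |}.

Lemma central_halts (f : lip1 X) : exists l, stops_at central_data f l.
Proof. by exists m; rewrite /stops_at /=. Qed.

Definition central_alg : det_alg X := DetAlg central_halts.

Lemma central_stop_index (f : lip1 X) : stop_index central_alg f = m.
Proof. by rewrite /stop_index; case: ex_minnP => k /eqP. Qed.

Lemma nth_central_observations (f : X -> R) l j : (j <= l)%N ->
  nth 0 (observations central_data f l) j = f (xs (inord j)).
Proof.
elim: l j => [|l IH] j.
  rewrite leqn0 => /eqP -> /=; congr (f (xs _)).
  by apply: val_inj; rewrite /= inordK.
rewrite leq_eqVlt ltnS nth_rcons size_tuple => /predU1P[->|jl].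
  by rewrite ltnn eqxx.
by rewrite ltnS jl IH.
Qed.

Lemma central_evalE (f : lip1 X) :
  alg_eval central_alg f = central_value (f \o xs).
Proof.
rewrite /alg_eval central_stop_index /=; congr central_value.
apply/funext => i; rewrite nth_central_observations ?inord_val//.
by rewrite -ltnS.
Qed.

Lemma alg_card_central : (alg_card central_alg <= (m.+1%:R)%:E)%E.
Proof.
apply: ge_ereal_sup => _ [f _ <-].
by rewrite /alg_card_at central_stop_index.
Qed.

Lemma alg_error_central (hmu : (\int[mu]_x (`|(x : X)|)%:E < +oo)%E) :
  (alg_error mu central_alg <= (lip1_integral mu (node_dist xs))%:E)%E.
Proof.
apply: ge_ereal_sup => _ [f _ <-]; rewrite lee_fin central_evalE.
exact: central_value_error.
Qed.

End UpperBound.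

Theorem theorem1 (R : realType) (X : completeNormedModType R)
    (mu : probability (borel X) R)
    (hmu : (\int[mu]_x (`|(x : X)|)%:E < +oo)%E)
    (n : nat) (hn : (0 < n)%N) :
  e_det mu n = quantization mu n.
Proof.
case: n hn => [//|m] _.
apply/eqP; rewrite eq_le; apply/andP; split; apply: le_ereal_inf_tmp.
- move=> _ [xs _ <-]; rewrite integral_min_dist//.
  apply: le_trans (alg_error_central mu xs hmu).
  apply: ereal_inf_lbound; exists (central_alg mu xs) => //=.
  exact: alg_card_central.
- move=> _ [A cardA <-]; apply: le_trans (alg_error_ge mu hmu m A cardA).
  rewrite -integral_min_dist//; apply: ereal_inf_lbound.
  by exists (fun i : 'I_m.+1 => query A lip1_zero i).
Qed.
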